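(* In the setting described in the context, let $\mathbf W^\diamond=[\mathbf W_c^\diamond,\mathbf W_s^\diamond]$ be a stationary point of the problem $\max\{f(\mathbf W):\mathrm{tr}(\mathbf W\mathbf W^H)\le P_t\}$ with associated Lagrange multiplier $\mu^\diamond\in\mathbb R$, i.e., $\nabla_{\mathbf W}\mathcal L(\mathbf W^\diamond,\mu^\diamond)=\mathbf 0$ where $\mathcal L(\mathbf W,\mu)=f(\mathbf W)-\mu(\mathrm{tr}(\mathbf W\mathbf W^H)-P_t)$, and let $\bm\Sigma_1^\diamond,\bm\Sigma_2^\diamond,\mathbf Q^\diamond$ be the quantities of the context evaluated at $\mathbf W^\diamond$. Then $$\Big(\tfrac12\delta_s(\mathbf Q^\diamond+\mathbf Q^{\diamond H})-\delta_c\mathbf H\bm\Sigma_2^\diamond\mathbf H^H\Big)\mathbf W_s^\diamond=\mu^\diamond\mathbf W_s^\diamond,$$ and, provided the matrix $\mu^\diamond\mathbf I+\delta_c\mathbf H\bm\Sigma_2^\diamond\mathbf H^H-\frac12\delta_s(\mathbf Q^\diamond+\mathbf Q^{\diamond H})$ is invertible, $$\mathbf W_c^\diamond=\Big(\mu^\diamond\mathbf I+\delta_c\mathbf H\bm\Sigma_2^\diamond\mathbf H^H-\tfrac12\delta_s(\mathbf Q^\diamond+\mathbf Q^{\diamond H})\Big)^{-1}\delta_c\mathbf H\bm\Sigma_1^{\diamond H}.$$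
   Context: Positive integers $N_t,N_r,K,M,L$, nonnegative integer $N_s$; channels $\mathbf h_k\in\mathbb C^{N_t}$, $\mathbf H=[\mathbf h_1,\dots,\mathbf h_K]$, noise variances $\sigma_{ck}^2>0$; $\sigma_s^2>0$; weights $\delta_c,\delta_s\ge0$; $P_t>0$. $\mathbf W=[\mathbf W_c,\mathbf W_s]\in\mathbb C^{N_t\times(K+N_s)}$, $\mathbf W_c=[\mathbf w_{c1},\dots,\mathbf w_{cK}]$, $\mathbf R_x=\mathbf W\mathbf W^H$. Rate $R_k(\mathbf W)=\log(1+|\mathbf h_k^H\mathbf w_{ck}|^2/I_k)$, $I_k=\sum_{j\ne k}|\mathbf h_k^H\mathbf w_{cj}|^2+\|\mathbf h_k^H\mathbf W_s\|_F^2+\sigma_{ck}^2$. Sensing model: differentiable $\mathbf a:\mathbb R^2\to\mathbb C^{N_t}$, $\mathbf b:\mathbb R^2\to\mathbb C^{N_r}$; parameters $\theta_m,\phi_m\in\mathbb R,\alpha_m\in\mathbb C$; $\mathbf A=[\mathbf a(\theta_m,\phi_m)]_m$, $\mathbf B=[\mathbf b(\theta_m,\phi_m)]_m$, $\mathbf U=\mathrm{diag}(\alpha_m)$; $\dot{\mathbf A}_\theta,\dot{\mathbf A}_\phi,\dot{\mathbf B}_\theta,\dot{\mathbf B}_\phi$ have $m$-th columns the partial derivatives of $\mathbf a$ resp. $\mathbf b$ w.r.t. first resp. second argument at $(\theta_m,\phi_m)$. $\mathbf F(\mathbf W)=\frac{2L}{\sigma_s^2}\begin{bmatrix}\Re\mathbf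 F_{11}&\Re\mathbf F_{12}&\Re\mathbf F_{13}&-\Im\mathbf F_{13}\\ \Re\mathbf F_{12}^{\mathsf T}&\Re\mathbf F_{22}&\Re\mathbf F_{23}&-\Im\mathbf F_{23}\\ \Re\mathbf F_{13}^{\mathsf T}&\Re\mathbf F_{23}^{\mathsf T}&\Re\mathbf F_{33}&-\Im\mathbf F_{33}\\ -\Im\mathbf F_{13}^{\mathsf T}&-\Im\mathbf F_{23}^{\mathsf T}&-\Im\mathbf F_{33}^{\mathsf T}&\Re\mathbf F_{33}\end{bmatrix}$ with $\mathbf F_{11}=(\mathbf U\mathbf A^H\mathbf R_x\mathbf A\mathbf U^H)^{\mathsf T}\odot(\dot{\mathbf B}_\theta^H\dot{\mathbf B}_\theta)+(\mathbf U\mathbf A^H\mathbf R_x\dot{\mathbf A}_\theta\mathbf U^H)^{\mathsf T}\odot(\mathbf B^H\dot{\mathbf B}_\theta)+(\mathbf U\dot{\mathbf A}_\theta^H\mathbf R_x\mathbf A\mathbf U^H)^{\mathsf T}\odot(\dot{\mathbf B}_\theta^H\mathbf B)+(\mathbf U\dot{\mathbf A}_\theta^H\mathbf R_x\dot{\mathbf A}_\theta\mathbf U^H)^{\mathsf T}\odot(\mathbf B^H\mathbf B)$; $\mathbf F_{12}=(\mathbf U\mathbf A^H\mathbf R_x\mathbf A\mathbf U^H)^{\mathsf T}\odot(\dot{\mathbf B}_\theta^H\dot{\mathbf B}_\phi)+(\mathbf U\mathbf A^H\mathbf R_x\dot{\mathbf A}_\theta\mathbf U^H)^{\mathsf T}\odot(\mathbf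 B^H\dot{\mathbf B}_\phi)+(\mathbf U\dot{\mathbf A}_\phi^H\mathbf R_x\mathbf A\mathbf U^H)^{\mathsf T}\odot(\dot{\mathbf B}_\theta^H\mathbf B)+(\mathbf U\dot{\mathbf A}_\phi^H\mathbf R_x\dot{\mathbf A}_\theta\mathbf U^H)^{\mathsf T}\odot(\mathbf B^H\mathbf B)$; $\mathbf F_{22}$ = $\mathbf F_{11}$ with $\theta\to\phi$; $\mathbf F_{13}=(\mathbf A^H\mathbf R_x\mathbf A\mathbf U^H)^{\mathsf T}\odot(\dot{\mathbf B}_\theta^H\mathbf B)+(\mathbf A^H\mathbf R_x\dot{\mathbf A}_\theta\mathbf U^H)^{\mathsf T}\odot(\mathbf B^H\mathbf B)$; $\mathbf F_{23}$ = $\mathbf F_{13}$ with $\theta\to\phi$; $\mathbf F_{33}=(\mathbf A^H\mathbf R_x\mathbf A)^{\mathsf T}\odot(\mathbf B^H\mathbf B)$. $f(\mathbf W)=\delta_c\sum_kR_k(\mathbf W)-\delta_s\mathrm{tr}(\mathbf F(\mathbf W)^{-1})$ ($\mathbf F$ assumed invertible at the points considered). Gradient convention: $\nabla g=\partial g/\partial\Re\mathbf W+\mathrm j\,\partial g/\partial\Im\mathbf W$. Quantities at $\mathbf W$: $T_k=I_k+|\mathbf h_k^H\mathbf w_{ck}|^2$, $\xi_k=|\mathbf h_k^H\mathbf w_{ck}|^2/I_k$, $\eta_k=\overline{\mathbf h_k^H\mathbf w_{ck}}/I_k$, $\beta_k=\xi_k/T_k$, $\bm\Sigma_1=\mathrm{diag}(\eta_k)$,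 $\bm\Sigma_2=\mathrm{diag}(\beta_k)$; $\bm\Phi=\mathbf F(\mathbf W)^{-2}$ with $M\times M$ blocks $\bm\Phi_{pq}$; $\mathbf Q_{11}=\mathbf A\mathbf U^H(\bm\Phi_{11}\odot\dot{\mathbf B}_\theta^H\dot{\mathbf B}_\theta)\mathbf U\mathbf A^H+\dot{\mathbf A}_\theta\mathbf U^H(\bm\Phi_{11}\odot\mathbf B^H\dot{\mathbf B}_\theta)\mathbf U\mathbf A^H+\mathbf A\mathbf U^H(\bm\Phi_{11}\odot\dot{\mathbf B}_\theta^H\mathbf B)\mathbf U\dot{\mathbf A}_\theta^H+\dot{\mathbf A}_\theta\mathbf U^H(\bm\Phi_{11}\odot\mathbf B^H\mathbf B)\mathbf U\dot{\mathbf A}_\theta^H$; $\mathbf Q_{12}=2[\mathbf A\mathbf U^H(\bm\Phi_{12}\odot\dot{\mathbf B}_\theta^H\dot{\mathbf B}_\phi)\mathbf U\mathbf A^H+\dot{\mathbf A}_\theta\mathbf U^H(\bm\Phi_{12}\odot\mathbf B^H\dot{\mathbf B}_\phi)\mathbf U\mathbf A^H+\mathbf A\mathbf U^H(\bm\Phi_{12}\odot\dot{\mathbf B}_\theta^H\mathbf B)\mathbf U\dot{\mathbf A}_\phi^H+\dot{\mathbf A}_\theta\mathbf U^H(\bm\Phi_{12}\odot\mathbf B^H\mathbf B)\mathbf U\dot{\mathbf A}_\phi^H]$; $\mathbf Q_{22}$ = $\mathbf Q_{11}$ with $\bm\Phi_{11}\to\bm\Phi_{22}$, $\theta\to\phi$;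 $\mathbf Q_{13}=\mathbf A\mathbf U^H((2\bm\Phi_{13}+2\mathrm j\bm\Phi_{14})\odot\dot{\mathbf B}_\theta^H\mathbf B)\mathbf A^H+\dot{\mathbf A}_\theta\mathbf U^H((2\bm\Phi_{13}+2\mathrm j\bm\Phi_{14})\odot\mathbf B^H\mathbf B)\mathbf A^H$; $\mathbf Q_{23}$ = $\mathbf Q_{13}$ with $\bm\Phi_{13},\bm\Phi_{14}\to\bm\Phi_{23},\bm\Phi_{24}$, $\theta\to\phi$; $\mathbf Q_{33}=\mathbf A((\bm\Phi_{33}+\bm\Phi_{44}+2\mathrm j\bm\Phi_{34})\odot\mathbf B^H\mathbf B)\mathbf A^H$; $\mathbf Q=\frac{2L}{\sigma_s^2}(\mathbf Q_{11}+\mathbf Q_{12}+\mathbf Q_{13}+\mathbf Q_{22}+\mathbf Q_{23}+\mathbf Q_{33})$; $\mathrm j$ imaginary unit. *)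

(* Defs.v *)
(* MathComp 2.5 + MathComp-Analysis 1.16 + real-closed (complex R[i]). *)
From HB Require Import structures.
From mathcomp Require Import all_boot all_order all_algebra.
From mathcomp Require Import complex.
From mathcomp Require Import all_classical all_reals all_analysis.
Import Order.TTheory GRing.Theory Num.Theory.
Import numFieldNormedType.Exports.

Set Implicit Arguments.
Unset Strict Implicit.
Unset Printing Implicit Defensive.

Local Open Scope ring_scope.
Local Open Scope complex_scope.

Section Defs.
Variable R : realType.
Local Notation C := (R[i]).

(* conjugate transpose  A^H *)
Definition ctr m n (A : 'M[C]_(m, n)) : 'M[C]_(n, m) := (map_mx (fun z => z^*) A)^T.
(* Hadamard (entrywise) product *)
Definition hadm m n (A B : 'M[C]_(m, n)) : 'M[C]_(m, n) := \matrix_(i, j) (A i j * B i j).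
(* entrywise real / imaginary part, and embedding of real matrices *)
Definition ReM m n (A : 'M[C]_(m, n)) : 'M[R]_(m, n) := map_mx (fun z => complex.Re z) A.
Definition ImM m n (A : 'M[C]_(m, n)) : 'M[R]_(m, n) := map_mx (fun z => complex.Im z) A.
Definition cR m n (A : 'M[R]_(m, n)) : 'M[C]_(m, n) := map_mx (fun x : R => x%:C) A.
(* |z|^2 *)
Definition sqn (z : C) : R := complex.Re z ^+ 2 + complex.Im z ^+ 2.

(* ---- Sensing model ---- *)
(* A = [a(theta_m, phi_m)]_m *)
Definition steer N M (a : R * R -> 'I_N -> C) (th ph : 'I_M -> R) : 'M[C]_(N, M) :=
  \matrix_(k, m) a (th m, ph m) k.
(* matrix whose m-th column is the directional derivative of a along v at (theta_m, phi_m);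
   v = (1,0): partial w.r.t. first argument, v = (0,1): partial w.r.t. second argument *)
Definition dsteer N M (a : R * R -> 'I_N -> C) (v : R * R) (th ph : 'I_M -> R)
  : 'M[C]_(N, M) :=
  \matrix_(k, m) ((('D_v (fun p : R * R => complex.Re (a p k)) (th m, ph m)))%:C
                  + 'i * (('D_v (fun p : R * R => complex.Im (a p k)) (th m, ph m)))%:C).
Definition Umat M (alpha : 'I_M -> C) : 'M[C]_M := diag_mx (\row_m alpha m).

Section Fisher.
Variables (Nt Nr M : nat) (A Adt Adp : 'M[C]_(Nt, M)) (B Bdt Bdp : 'M[C]_(Nr, M))
  (U : 'M[C]_M) (L : nat) (sigs2 : R).

Definition F11g (Ad : 'M[C]_(Nt, M)) (Bd : 'M[C]_(Nr, M)) (Rx : 'M[C]_Nt) : 'M[C]_M :=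
    hadm (U *m ctr A *m Rx *m A *m ctr U)^T (ctr Bd *m Bd)
  + hadm (U *m ctr A *m Rx *m Ad *m ctr U)^T (ctr B *m Bd)
  + hadm (U *m ctr Ad *m Rx *m A *m ctr U)^T (ctr Bd *m B)
  + hadm (U *m ctr Ad *m Rx *m Ad *m ctr U)^T (ctr B *m B).
Definition F12 (Rx : 'M[C]_Nt) : 'M[C]_M :=
    hadm (U *m ctr A *m Rx *m A *m ctr U)^T (ctr Bdt *m Bdp)
  + hadm (U *m ctr A *m Rx *m Adt *m ctr U)^T (ctr B *m Bdp)
  + hadm (U *m ctr Adp *m Rx *m A *m ctr U)^T (ctr Bdt *m B)
  + hadm (U *m ctr Adp *m Rx *m Adt *m ctr U)^T (ctr B *m B).
Definition F13g (Ad : 'M[C]_(Nt, M)) (Bd : 'M[C]_(Nr, M)) (Rx : 'M[C]_Nt) : 'M[C]_M :=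
    hadm (ctr A *m Rx *m A *m ctr U)^T (ctr Bd *m B)
  + hadm (ctr A *m Rx *m Ad *m ctr U)^T (ctr B *m B).
Definition F33 (Rx : 'M[C]_Nt) : 'M[C]_M := hadm (ctr A *m Rx *m A)^T (ctr B *m B).

(* the 4M x 4M real matrix F, as a function of R_x *)
Definition Fmat (Rx : 'M[C]_Nt) : 'M[R]_(M + M + (M + M)) :=
  let F11 := F11g Adt Bdt Rx in let F22 := F11g Adp Bdp Rx in
  let F12 := F12 Rx in
  let F13 := F13g Adt Bdt Rx in let F23 := F13g Adp Bdp Rx in
  let F33 := F33 Rx in
  (2 * L%:R / sigs2) *:
  block_mx
    (block_mx (ReM F11) (ReM F12) (ReM F12)^T (ReM F22))
    (block_mx (ReM F13) (- ImM F13) (ReM F23) (- ImM F23))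
    (block_mx (ReM F13)^T (ReM F23)^T (- (ImM F13)^T) (- (ImM F23)^T))
    (block_mx (ReM F33) (- ImM F33) (- (ImM F33)^T) (ReM F33)).

(* Q, as a function of Phi = F^{-2} *)
Definition Q11g (P : 'M[R]_M) (Ad : 'M[C]_(Nt, M)) (Bd : 'M[C]_(Nr, M)) : 'M[C]_Nt :=
    A *m ctr U *m hadm (cR P) (ctr Bd *m Bd) *m U *m ctr A
  + Ad *m ctr U *m hadm (cR P) (ctr B *m Bd) *m U *m ctr A
  + A *m ctr U *m hadm (cR P) (ctr Bd *m B) *m U *m ctr Ad
  + Ad *m ctr U *m hadm (cR P) (ctr B *m B) *m U *m ctr Ad.
Definition Q12 (P : 'M[R]_M) : 'M[C]_Nt :=
  2 *: (A *m ctr U *m hadm (cR P) (ctr Bdt *m Bdp) *m U *m ctr A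
      + Adt *m ctr U *m hadm (cR P) (ctr B *m Bdp) *m U *m ctr A
      + A *m ctr U *m hadm (cR P) (ctr Bdt *m B) *m U *m ctr Adp
      + Adt *m ctr U *m hadm (cR P) (ctr B *m B) *m U *m ctr Adp).
Definition Q13g (P3 P4 : 'M[R]_M) (Ad : 'M[C]_(Nt, M)) (Bd : 'M[C]_(Nr, M)) : 'M[C]_Nt :=
  let G := 2 *: cR P3 + (2 * 'i) *: cR P4 in
    A *m ctr U *m hadm G (ctr Bd *m B) *m ctr A
  + Ad *m ctr U *m hadm G (ctr B *m B) *m ctr A.
Definition Q33 (P33 P44 P34 : 'M[R]_M) : 'M[C]_Nt :=
  A *m hadm (cR (P33 + P44) + (2 * 'i) *: cR P34) (ctr B *m B) *m ctr A.

Definition Qmat (Phi : 'M[R]_(M + M + (M + M))) : 'M[C]_Nt :=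
  let P11 := ulsubmx (ulsubmx Phi) in let P12 := ursubmx (ulsubmx Phi) in
  let P22 := drsubmx (ulsubmx Phi) in
  let P13 := ulsubmx (ursubmx Phi) in let P14 := ursubmx (ursubmx Phi) in
  let P23 := dlsubmx (ursubmx Phi) in let P24 := drsubmx (ursubmx Phi) in
  let P33 := ulsubmx (drsubmx Phi) in let P34 := ursubmx (drsubmx Phi) in
  let P44 := drsubmx (drsubmx Phi) in
  (2 * L%:R / sigs2)%:C *:
  (Q11g P11 Adt Bdt + Q12 P12 + Q13g P13 P14 Adt Bdt
   + Q11g P22 Adp Bdp + Q13g P23 P24 Adp Bdp + Q33 P33 P44 P34).

End Fisher.

(* ---- Communication part ---- *)
Section Comm.
Variables (Nt K Ns : nat) (H : 'M[C]_(Nt, K)) (sigc2 : 'I_K -> R).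

(* W_c = lsubmx W, W_s = rsubmx W *)
(* h_k^H w_cj *)
Definition hw (W : 'M[C]_(Nt, K + Ns)) (k j : 'I_K) : C := (ctr H *m lsubmx W) k j.
Definition Ik (W : 'M[C]_(Nt, K + Ns)) (k : 'I_K) : R :=
  \sum_(j < K | j != k) sqn (hw W k j)
  + \sum_(l < Ns) sqn ((ctr H *m rsubmx W) k l) + sigc2 k.
Definition rate (W : 'M[C]_(Nt, K + Ns)) (k : 'I_K) : R :=
  ln (1 + sqn (hw W k k) / Ik W k).
Definition Tk W k : R := Ik W k + sqn (hw W k k).
Definition xik W k : R := sqn (hw W k k) / Ik W k.
Definition etak W k : C := (hw W k k)^* / (Ik W k)%:C.
Definition betak W k : R := xik W k / Tk W k.
Definition Sigma1 W : 'M[C]_K := diag_mx (\row_k etak W k).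
Definition Sigma2 W : 'M[C]_K := diag_mx (\row_k (betak W k)%:C).
End Comm.

(* Objective f and Lagrangian *)
Definition fobj Nt Nr K Ns M (H : 'M[C]_(Nt, K)) (sigc2 : 'I_K -> R)
  (A Adt Adp : 'M[C]_(Nt, M)) (B Bdt Bdp : 'M[C]_(Nr, M)) (U : 'M[C]_M) (L : nat)
  (sigs2 dc ds : R) (W : 'M[C]_(Nt, K + Ns)) : R :=
  dc * (\sum_(k < K) rate H sigc2 W k)
  - ds * \tr (invmx (Fmat A Adt Adp B Bdt Bdp U L sigs2 (W *m ctr W))).

Definition lagr Nt Nr K Ns M (H : 'M[C]_(Nt, K)) (sigc2 : 'I_K -> R)
  (A Adt Adp : 'M[C]_(Nt, M)) (B Bdt Bdp : 'M[C]_(Nr, M)) (U : 'M[C]_M) (L : nat)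
  (sigs2 dc ds Pt : R) (W : 'M[C]_(Nt, K + Ns)) (mu : R) : R :=
  fobj H sigc2 A Adt Adp B Bdt Bdp U L sigs2 dc ds W
  - mu * (complex.Re (\tr (W *m ctr W)) - Pt).

(* grad_W g (W) = 0 with the convention grad g = dg/dRe W + j dg/dIm W:
   every partial derivative w.r.t. the real and the imaginary part of every entry
   exists and vanishes. *)
Definition grad_zero m n (g : 'M[C]_(m, n) -> R) (W : 'M[C]_(m, n)) : Prop :=
  forall (i : 'I_m) (j : 'I_n),
    is_derive (0 : R) (1 : R) (fun t : R => g (W + t%:C *: delta_mx i j)) 0 /\
    is_derive (0 : R) (1 : R) (fun t : R => g (W + (t%:C * 'i) *: delta_mx i j)) 0.

End Defs.

(* Main.v *)
(** The derivative of the Lagrangian at [W] along any direction [D] is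
    [2 Re tr (D^H G)] with
    [G = dc [H Sigma1^H, 0] + (ds/2 (Q + Q^H) - dc H Sigma2 H^H - mu I) W],
    so stationarity forces [G = 0], and the two column blocks of this equation
    are the two claims.  For the sensing term, [d tr F^-1 = - tr (F^-2 dF)], and
    since [F] depends real-linearly on [R_x], everything reduces to the duality
    [tr (Phi F(E)) = Re tr (Q(Phi) E)], valid for symmetric [Phi] and
    arbitrary [E].  [Phi = F^-2] is symmetric because [R_x] is Hermitian. *)

Require Import Defs.
From HB Require Import structures.
From mathcomp Require Import all_boot all_order all_algebra.
From mathcomp Require Import complex.
From mathcomp Require Import all_classical all_reals all_analysis.
From mathcomp Require Import ring.
Import Order.TTheory GRing.Theory Num.Theory.
Import numFieldNormedType.Exports.
Local Open Scope ring_scope.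
Local Open Scope complex_scope.

Set Implicit Arguments.
Unset Strict Implicit.
Unset Printing Implicit Defensive.

(** * Matrices of polynomials and the derivative of the trace of an inverse *)

Lemma is_derive_horner (R : realType) (p : {poly R}) (x : R) :
  is_derive x (1 : R) (horner p) p^`().[x].
Proof.
apply: DeriveDef; first exact: derivable_horner.
by rewrite -derive1E -derivE.
Qed.

Lemma deriv_mulmx (R : comNzRingType) (m n p : nat)
  (A : 'M[{poly R}]_(m, n)) (B : 'M[{poly R}]_(n, p)) :
  map_mx (@deriv R) (A *m B) =
  map_mx (@deriv R) A *m B + A *m map_mx (@deriv R) B.
Proof.
apply/matrixP=> i j; rewrite !mxE raddf_sum -big_split /=.
by apply: eq_bigr => k _; rewrite derivM !mxE.
Qed.

Lemma deriv_mxtrace (R : comNzRingType) (n : nat) (A : 'M[{poly R}]_n) :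
  \tr (map_mx (@deriv R) A) = (\tr A)^`().
Proof. by rewrite /mxtrace raddf_sum; apply: eq_bigr => i _; rewrite mxE. Qed.

(* Near [x] the trace is the rational function [\tr (\adj P) / \det P], so
   differentiability is that of polynomials; the value of the derivative comes
   from differentiating [\adj P *m P = (\det P)%:M]. *)
Lemma is_derive_mxtrace_invmx (R : realType) (n : nat) (P : 'M[{poly R}]_n) (x : R) :
  let ev t := map_mx (horner_eval t) in
  ev x P \in unitmx ->
  is_derive x (1 : R) (fun t => \tr (invmx (ev t P)))
    (- \tr (invmx (ev x P) *m ev x (map_mx (@deriv R) P) *m invmx (ev x P))).
Proof.
move=> ev Pu; set V := invmx _; set P' := ev x (map_mx _ P).
pose d := \det P; pose q := \tr (\adj P).
have evdet t : \det (ev t P) = d.[t] by rewrite /ev det_map_mx.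
have evadj t : \adj (ev t P) = ev t (\adj P) by rewrite /ev -map_mx_adj.
have evtr t (A : 'M[{poly R}]_n) : \tr (ev t A) = (\tr A).[t].
  by rewrite /ev trace_map_mx.
have dx : d.[x] != 0 by rewrite -evdet -unitfE -unitmxE.
(* [invmx] returns its argument on a singular matrix, so the rational formula is available only
   where [d] does not vanish, which covers a neighbourhood of [x]. *)
have nd : \near x, d.[x] != 0.
  exact: (cvgr_neq0 _ (@continuous_horner R d x) dx).
have invE t : d.[t] != 0 -> \tr (invmx (ev t P)) = q.[t] * d.[t]^-1.
  move=> dt; rewrite /invmx unitmxE evdet unitfE dt mxtraceZ evadj evtr.
  by rewrite mulrC.
have adjx : ev x (\adj P) = d.[x] *: V.
  by rewrite -evadj /V /invmx Pu scalerA evdet divff ?scale1r.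
have key : q^`().[x] = d^`().[x] * \tr V - d.[x] * \tr (V *m P' *m V).
  have := congr1 (fun A => ev x (map_mx (@deriv R) A)) (mul_adj_mx P).
  rewrite deriv_mulmx /ev map_mxD !map_mxM -/(ev x) -/P' adjx.
  have PV : map_mx (horner_eval x) P *m V = 1%:M := mulmxV Pu.
  have -> : ev x (map_mx (@deriv R) (\det P)%:M) = (d^`().[x])%:M.
    apply/matrixP=> i j; rewrite !mxE /horner_eval.
    by case: (i == j); rewrite ?mulr1n // mulr0n deriv0 horner0.
  (* Multiplying by [V] on the right isolates the derivative of the adjugate, whose trace is the
     derivative of [q]. *)
  move=> /(congr1 (fun A => A *m V)).
  rewrite mulmxDl -[X in X + _]mulmxA PV mulmx1 mul_scalar_mx.
  move=> /(congr1 (fun A => \tr A)); rewrite mxtraceD -!scalemxAl !mxtraceZ.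
  by rewrite evtr deriv_mxtrace => <-; rewrite addrK.
apply: (@near_eq_is_derive _ _ _ (fun t => q.[t] * d.[t]^-1)).
  by near=> t; rewrite invE //; near: t.
have Dq := is_derive_horner q x; have Dd := is_derive_horner d x.
have DV := is_deriveV dx Dd.
have D := is_deriveM Dq DV; refine (is_derive_eq D _).
rewrite key.
(* With this value of [q], the terms containing the derivative of [d] cancel in the quotient
   rule. *)
have trV : q.[x] = d.[x] * \tr V by rewrite -evtr adjx mxtraceZ.
rewrite trV /GRing.scale /=.
by field.
Unshelve. all: by end_near.
Qed.

(* [Num.Theory] shadows these two names. *)
Local Notation ReM := Defs.ReM.
Local Notation ImM := Defs.ImM.

(** * Real and imaginary parts *)

Lemma ReD (R : realType) (x y : R[i]) :
  complex.Re (x + y) = complex.Re x + complex.Re y.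
Proof. by case: x; case: y. Qed.

Lemma ImD (R : realType) (x y : R[i]) :
  complex.Im (x + y) = complex.Im x + complex.Im y.
Proof. by case: x; case: y. Qed.

Lemma ReZ (R : realType) (t : R) (x : R[i]) :
  complex.Re (t%:C * x) = t * complex.Re x.
Proof. by case: x => u v /=; rewrite mul0r subr0. Qed.

Lemma ImZ (R : realType) (t : R) (x : R[i]) :
  complex.Im (t%:C * x) = t * complex.Im x.
Proof. by case: x => u v /=; rewrite mul0r addr0. Qed.

Lemma ReN (R : realType) (x : R[i]) : complex.Re (- x) = - complex.Re x.
Proof. by case: x. Qed.

Lemma Re_sum (R : realType) (I : finType) (F : I -> R[i]) :
  complex.Re (\sum_i F i) = \sum_i complex.Re (F i).
Proof. exact: (big_morph _ (@ReD R) erefl). Qed.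

Lemma mxtrace_trDl (K : comPzRingType) m n (G1 G2 X : 'M[K]_(m, n)) :
  \tr ((G1 + G2)^T *m X) = \tr (G1^T *m X) + \tr (G2^T *m X).
Proof. by rewrite linearD mulmxDl mxtraceD. Qed.

Lemma mxtrace_trZl (K : comPzRingType) m n c (G X : 'M[K]_(m, n)) :
  \tr ((c *: G)^T *m X) = c * \tr (G^T *m X).
Proof. by rewrite linearZ -scalemxAl mxtraceZ. Qed.

(** * Conjugate transpose, Hadamard product and traces *)

Section Ctr.
Variable R : realType.
Local Notation C := (R[i]).
Implicit Types (m n p : nat) (t : R).

Lemma ctrK m n (A : 'M[C]_(m, n)) : ctr (ctr A) = A.
Proof. by apply/matrixP=> i j; rewrite !mxE !conjcK. Qed.

Lemma ctrM m n p (A : 'M[C]_(m, n)) (B : 'M[C]_(n, p)) :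
  ctr (A *m B) = ctr B *m ctr A.
Proof. by rewrite /ctr (map_mxM (@conjc R)) trmx_mul. Qed.

Lemma ctrD m n (A B : 'M[C]_(m, n)) : ctr (A + B) = ctr A + ctr B.
Proof. by apply/matrixP=> i j; rewrite !mxE rmorphD. Qed.

Lemma ctrZ m n t (A : 'M[C]_(m, n)) : ctr (t%:C *: A) = t%:C *: ctr A.
Proof. by apply/matrixP=> i j; rewrite !mxE rmorphM; congr (_ * _); exact: conjc_real. Qed.

Lemma Re_mxtrace_ctr n (A : 'M[C]_n) :
  complex.Re (\tr (ctr A)) = complex.Re (\tr A).
Proof.
rewrite /ctr mxtrace_tr (trace_map_mx (@conjc R)) /=.
by case: (\tr A).
Qed.

Lemma ReMD m n (A B : 'M[C]_(m, n)) : ReM (A + B) = ReM A + ReM B.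
Proof. by apply/matrixP=> i j; rewrite !mxE ReD. Qed.

Lemma ImMD m n (A B : 'M[C]_(m, n)) : ImM (A + B) = ImM A + ImM B.
Proof. by apply/matrixP=> i j; rewrite !mxE ImD. Qed.

Lemma ReMZ m n t (A : 'M[C]_(m, n)) : ReM (t%:C *: A) = t *: ReM A.
Proof. by apply/matrixP=> i j; rewrite !mxE ReZ. Qed.

Lemma ImMZ m n t (A : 'M[C]_(m, n)) : ImM (t%:C *: A) = t *: ImM A.
Proof. by apply/matrixP=> i j; rewrite !mxE ImZ. Qed.

Lemma hadmDl m n (A B D : 'M[C]_(m, n)) : hadm (A + B) D = hadm A D + hadm B D.
Proof. by apply/matrixP=> i j; rewrite !mxE mulrDl. Qed.

Lemma hadmZl m n (c : C) (A D : 'M[C]_(m, n)) : hadm (c *: A) D = c *: hadm A D.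
Proof. by apply/matrixP=> i j; rewrite !mxE mulrA. Qed.

Lemma ctr_hadm m n (A B : 'M[C]_(m, n)) : ctr (hadm A B) = hadm (ctr A) (ctr B).
Proof. by apply/matrixP=> i j; rewrite !mxE rmorphM. Qed.

Lemma ctr_tr m n (A : 'M[C]_(m, n)) : ctr A^T = (ctr A)^T.
Proof. by apply/matrixP=> i j; rewrite !mxE. Qed.

Lemma ReM_hermitian n (A : 'M[C]_n) : ctr A = A -> (ReM A)^T = ReM A.
Proof.
by move=> hA; apply/matrixP=> i j; rewrite -[in RHS]hA !mxE; case: (A j i).
Qed.

Lemma mxtrace_tr_ReM n (P : 'M[R]_n) (X : 'M[C]_n) :
  \tr (P^T *m ReM X) = complex.Re (\tr ((cR P)^T *m X)).
Proof.
rewrite /mxtrace Re_sum; apply: eq_bigr => i _.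
by rewrite !mxE Re_sum; apply: eq_bigr => j _; rewrite !mxE ReZ.
Qed.

(** By Im z = - Re (i z), an imaginary part is traded for a factor i on the weight; the terms of Q
    with the imaginary unit arise this way. *)
Lemma mxtrace_tr_ImM n (P : 'M[R]_n) (X : 'M[C]_n) :
  \tr (P^T *m ImM X) = - complex.Re (\tr (('i *: cR P)^T *m X)).
Proof.
rewrite /mxtrace Re_sum -sumrN; apply: eq_bigr => i _.
rewrite !mxE Re_sum -sumrN; apply: eq_bigr => j _; rewrite !mxE.
by case: (X j i) => u v /=; ring.
Qed.

(** Both sides are the sum of the G_ij Y_ij X_ji. The Hadamard factor [Y] moves from the Fisher
    block to the weight, which produces the kernels of Q. *)
Lemma mxtrace_tr_hadm m n (G Y : 'M[C]_(m, n)) (X : 'M[C]_(n, m)) :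
  \tr (G^T *m hadm X^T Y) = \tr (hadm G Y *m X).
Proof.
rewrite /mxtrace.
under eq_bigr do rewrite mxE.
under [RHS]eq_bigr do rewrite mxE.
rewrite exchange_big /=; apply: eq_bigr => i _; apply: eq_bigr => j _.
by rewrite !mxE mulrA mulrAC.
Qed.

End Ctr.

Lemma addr4ACA (V : nmodType) (a1 a2 b1 b2 c1 c2 d1 d2 : V) :
  (a1 + a2) + (b1 + b2) + (c1 + c2) + (d1 + d2) =
  (a1 + b1 + c1 + d1) + (a2 + b2 + c2 + d2).
Proof. by rewrite (addrACA a1) (addrACA (a1 + b1)) (addrACA (a1 + b1 + c1)). Qed.

(** * The Fisher matrix: real linearity, symmetry and duality with Q *)

Section Fisher.
Variable R : realType.
Local Notation C := (R[i]).
Variables (Nt Nr M : nat) (A Adt Adp : 'M[C]_(Nt, M)) (B Bdt Bdp : 'M[C]_(Nr, M))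
  (U : 'M[C]_M) (L : nat) (sigs2 : R).
Local Notation F11 := (@F11g R Nt Nr M A B U).
Local Notation F12 := (@Defs.F12 R Nt Nr M A Adt Adp B Bdt Bdp U).
Local Notation F13 := (@F13g R Nt Nr M A B U).
Local Notation F33 := (@Defs.F33 R Nt Nr M A B).
Local Notation F := (@Fmat R Nt Nr M A Adt Adp B Bdt Bdp U L sigs2).
Local Notation Q := (@Qmat R Nt Nr M A Adt Adp B Bdt Bdp U L sigs2).
Implicit Types (X Y E : 'M[C]_Nt) (t : R) (Ad : 'M[C]_(Nt, M)) (Bd : 'M[C]_(Nr, M)).

(** The common shape of all summands of the Fisher blocks: linearity, conjugate transposition and
    trace duality are checked once, on it. *)
Definition sandwich m n (P : 'M[C]_(m, Nt)) (S : 'M[C]_(Nt, n)) (Z : 'M[C]_(n, m)) X :=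
  hadm (P *m X *m S)^T Z.

Lemma sandwich_lin m n (P : 'M[C]_(m, Nt)) (S : 'M[C]_(Nt, n)) (Z : 'M[C]_(n, m)) X t Y :
  sandwich P S Z (X + t%:C *: Y) = sandwich P S Z X + t%:C *: sandwich P S Z Y.
Proof.
rewrite /sandwich mulmxDr mulmxDl -scalemxAr -scalemxAl linearD linearZ.
by rewrite hadmDl hadmZl.
Qed.

Lemma sandwichE m n p (P : 'M[C]_(m, Nt)) (S : 'M[C]_(Nt, p)) (T : 'M[C]_(p, n))
    (Z : 'M[C]_(n, m)) X :
  hadm (P *m X *m S *m T)^T Z = sandwich P (S *m T) Z X.
Proof. by rewrite /sandwich mulmxA. Qed.

Lemma F11gE Ad Bd X : F11 Ad Bd X =
    sandwich (U *m ctr A) (A *m ctr U) (ctr Bd *m Bd) X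
  + sandwich (U *m ctr A) (Ad *m ctr U) (ctr B *m Bd) X
  + sandwich (U *m ctr Ad) (A *m ctr U) (ctr Bd *m B) X
  + sandwich (U *m ctr Ad) (Ad *m ctr U) (ctr B *m B) X.
Proof. by congr (_ + _ + _ + _); apply: sandwichE. Qed.

Lemma F12E X : F12 X =
    sandwich (U *m ctr A) (A *m ctr U) (ctr Bdt *m Bdp) X
  + sandwich (U *m ctr A) (Adt *m ctr U) (ctr B *m Bdp) X
  + sandwich (U *m ctr Adp) (A *m ctr U) (ctr Bdt *m B) X
  + sandwich (U *m ctr Adp) (Adt *m ctr U) (ctr B *m B) X.
Proof. by congr (_ + _ + _ + _); apply: sandwichE. Qed.

Lemma F13gE Ad Bd X : F13 Ad Bd X =
    sandwich (ctr A) (A *m ctr U) (ctr Bd *m B) X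
  + sandwich (ctr A) (Ad *m ctr U) (ctr B *m B) X.
Proof. by congr (_ + _); apply: sandwichE. Qed.

Lemma F33E X : F33 X = sandwich (ctr A) A (ctr B *m B) X.
Proof. by []. Qed.

Lemma F11g_lin Ad Bd X t Y :
  F11 Ad Bd (X + t%:C *: Y) = F11 Ad Bd X + t%:C *: F11 Ad Bd Y.
Proof.
rewrite !F11gE !sandwich_lin !scalerDr.
exact: addr4ACA.
Qed.

Lemma F12_lin X t Y : F12 (X + t%:C *: Y) = F12 X + t%:C *: F12 Y.
Proof.
rewrite !F12E !sandwich_lin !scalerDr.
exact: addr4ACA.
Qed.

Lemma F13g_lin Ad Bd X t Y :
  F13 Ad Bd (X + t%:C *: Y) = F13 Ad Bd X + t%:C *: F13 Ad Bd Y.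
Proof. by rewrite !F13gE !sandwich_lin !scalerDr addrACA. Qed.

Lemma F33_lin X t Y : F33 (X + t%:C *: Y) = F33 X + t%:C *: F33 Y.
Proof. by rewrite !F33E sandwich_lin. Qed.

(** The scalar is real because the entrywise real and imaginary parts are only real-linear. *)
Lemma Fmat_lin X t Y : F (X + t%:C *: Y) = F X + t *: F Y.
Proof.
rewrite /Fmat F11g_lin F11g_lin F12_lin F13g_lin F13g_lin F33_lin.
move: (F11 _ _ X) (F11 _ _ Y) (F11 _ _ X) (F11 _ _ Y) (F12 X) (F12 Y).
move: (F13 _ _ X) (F13 _ _ Y) (F13 _ _ X) (F13 _ _ Y) (F33 X) (F33 Y).
move=> a a' b b' c c' d d' e e' f f'.
rewrite !ReMD !ReMZ !ImMD !ImMZ.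
move: (2 * _ / _) => k.
rewrite (scalerA t k) (mulrC t k) -(scalerA k t) -(scalerDr k); congr (_ *: _).
rewrite !scale_block_mx.
rewrite !add_block_mx.
by rewrite !linearD !linearZ.
Qed.

Lemma realcD (x y : R) : (x + y)%:C = x%:C + y%:C.
Proof. by apply/eqP; rewrite eq_complex /= addr0 !eqxx. Qed.

Lemma Re_mul2 (z : C) : complex.Re (2 * z) = 2 * complex.Re z.
Proof. by rewrite -ReZ rmorph_nat. Qed.

Lemma ctr_sandwich m n (P : 'M[C]_(m, Nt)) (S : 'M[C]_(Nt, n)) (Z : 'M[C]_(n, m)) X :
  ctr X = X -> ctr (sandwich P S Z X) = sandwich (ctr S) (ctr P) (ctr Z) X.
Proof.
by move=> hX; rewrite /sandwich ctr_hadm ctr_tr !ctrM hX mulmxA.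
Qed.

(** Conjugate transposition fixes the first and last summands and exchanges the two middle ones. *)
Lemma ctr_F11g Ad Bd X : ctr X = X -> ctr (F11 Ad Bd X) = F11 Ad Bd X.
Proof.
move=> hX; rewrite F11gE !ctrD !(ctr_sandwich _ _ _ hX) !ctrM !ctrK.
by congr (_ + _); exact: addrAC.
Qed.

Lemma ctr_F33 X : ctr X = X -> ctr (F33 X) = F33 X.
Proof. by move=> hX; rewrite F33E (ctr_sandwich _ _ _ hX) !ctrM !ctrK. Qed.

Lemma trmxN (V : zmodType) m n (Z : 'M[V]_(m, n)) : (- Z)^T = - Z^T.
Proof. by apply/matrixP=> i j; rewrite !mxE. Qed.

(** Blocks in mirrored positions are transposes of each other by construction; that [X] is Hermitian
    makes the real parts of F11, F22 and F33 symmetric. *)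
Lemma trmx_Fmat X : ctr X = X -> (F X)^T = F X.
Proof.
move=> hX; rewrite /Fmat; move: (2 * _ / _) => k.
have s11 := ReM_hermitian (ctr_F11g Adt Bdt hX).
have s22 := ReM_hermitian (ctr_F11g Adp Bdp hX).
have s33 := ReM_hermitian (ctr_F33 hX).
move: s11 s22 s33; move: (F11 _ _ X) (F11 _ _ X) (F12 X).
move: (F13 _ _ X) (F13 _ _ X) (F33 X) => d e f a b c s11 s22 s33.
(* Signs go inside the transposes, so that the lower blocks become literal transposes of the upper
   ones. *)
rewrite -!trmxN linearZ /=.
by rewrite !(tr_block_mx, trmxK) s11 s22 s33.
Qed.

(** Hadamard duality followed by cyclicity of the trace; it turns each summand of a Fisher block
    into the matching summand of Q. *)
Lemma mxtrace_sandwich m n (P : 'M[C]_(m, Nt)) (S : 'M[C]_(Nt, n)) (Z G : 'M[C]_(n, m)) E :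
  \tr (G^T *m sandwich P S Z E) = \tr (S *m hadm G Z *m P *m E).
Proof. by rewrite mxtrace_tr_hadm mulmxA mxtrace_mulC !mulmxA. Qed.

Lemma mxtrace_F11 (P : 'M[R]_M) Ad Bd E :
  \tr (P^T *m ReM (F11 Ad Bd E)) = complex.Re (\tr (Q11g A B U P Ad Bd *m E)).
Proof.
rewrite mxtrace_tr_ReM F11gE !mulmxDr !mulmxDl !(mxtraceD (_ + _)) mxtraceD.
rewrite [in RHS]mxtraceD.
by congr (complex.Re (_ + _ + _ + _)); rewrite mxtrace_sandwich !mulmxA.
Qed.

(** The factor 2 counts the block Re F12 together with its transpose in F. *)
Lemma mxtrace_F12 (P : 'M[R]_M) E :
  2 * \tr (P^T *m ReM (F12 E)) =
  complex.Re (\tr (Q12 A Adt Adp B Bdt Bdp U P *m E)).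
Proof.
rewrite mxtrace_tr_ReM F12E /Q12 -scalemxAl (mxtraceZ 2%:R).
rewrite !mulmxDr !mulmxDl !(mxtraceD (_ + _)) mxtraceD.
rewrite [in RHS]mxtraceD.
rewrite Re_mul2; congr (_ * complex.Re _).
by congr (_ + _ + _ + _); rewrite mxtrace_sandwich !mulmxA.
Qed.

(** The blocks Re F13 and - Im F13 each occur in F together with their transposes; their weights
    merge into the complex weight 2 P3 + 2i P4. *)
Lemma mxtrace_F13 (P3 P4 : 'M[R]_M) Ad Bd E :
  2 * \tr (P3^T *m ReM (F13 Ad Bd E)) - 2 * \tr (P4^T *m ImM (F13 Ad Bd E)) =
  complex.Re (\tr (Q13g A B U P3 P4 Ad Bd *m E)).
Proof.
rewrite mxtrace_tr_ReM mxtrace_tr_ImM mulrN opprK.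
set G := 2 *: cR P3 + (2 * 'i) *: cR P4.
transitivity (complex.Re (\tr (G^T *m F13 Ad Bd E))).
  have -> : G^T = 2 *: ((cR P3)^T + ('i *: cR P4)^T).
    by apply/matrixP=> i j; rewrite !mxE mulrDr mulrA.
  by rewrite -scalemxAl mxtraceZ mulmxDl mxtraceD Re_mul2 ReD mulrDr.
rewrite F13gE /Q13g !mulmxDr !mulmxDl !mxtraceD.
by congr (complex.Re (_ + _)); exact: mxtrace_sandwich.
Qed.

Lemma cRD m n (P1 P2 : 'M[R]_(m, n)) : cR (P1 + P2) = cR P1 + cR P2.
Proof.
apply/matrixP=> i j.
rewrite [LHS]mxE [in LHS]mxE [RHS]mxE realcD.
by rewrite [X in _ = X + _]mxE [X in _ = _ + X]mxE.
Qed.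

Lemma Re_mxtrace_tr_lin3 n (G1 G2 G3 X : 'M[C]_n) :
  complex.Re (\tr ((G1 + G2 + (2 * 'i) *: G3)^T *m X)) =
  complex.Re (\tr (G1^T *m X)) + complex.Re (\tr (G2^T *m X)) +
  2 * complex.Re (\tr (('i *: G3)^T *m X)).
Proof.
rewrite -Re_mul2 -2!ReD; congr complex.Re.
rewrite -(scalerA 2).
move: ('i *: G3) => {}G3.
rewrite (mxtrace_trDl (G1 + G2)) (mxtrace_trDl G1).
by rewrite (mxtrace_trZl 2 G3).
Qed.

(** Re F33 occupies two diagonal positions with separate weights, whereas - Im F33 and its transpose
    share the weight [P34], hence the factor 2. *)
Lemma mxtrace_F33 (P33 P44 P34 : 'M[R]_M) E :
  \tr (P33^T *m ReM (F33 E)) + \tr (P44^T *m ReM (F33 E))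
    - 2 * \tr (P34^T *m ImM (F33 E)) =
  complex.Re (\tr (Q33 A B P33 P44 P34 *m E)).
Proof.
rewrite !mxtrace_tr_ReM mxtrace_tr_ImM mulrN opprK.
transitivity (complex.Re (\tr ((cR (P33 + P44) + (2 * 'i) *: cR P34)^T *m F33 E))).
  rewrite cRD; symmetry; exact: Re_mxtrace_tr_lin3.
rewrite F33E.
by congr complex.Re; exact: mxtrace_sandwich.
Qed.

(** The trace is expanded block by block. [Qmat] reads only the upper blocks of [Phi]; symmetry
    recovers the others as their transposes. *)
Lemma mxtrace_Fmat (Phi : 'M[R]_(M + M + (M + M))) E : Phi^T = Phi ->
  \tr (Phi *m F E) = complex.Re (\tr (Q Phi *m E)).
Proof.
move=> symPhi; rewrite -{1}symPhi /Qmat /Fmat.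
set c := 2 * _ / _.
rewrite -(scalemxAr c) mxtraceZ -(scalemxAl c%:C) mxtraceZ ReZ; congr (_ * _).
have sum6 (X1 X2 X3 X4 X5 X6 : 'M[C]_Nt) :
    complex.Re (\tr ((X1 + X2 + X3 + X4 + X5 + X6) *m E)) =
    complex.Re (\tr (X1 *m E)) + complex.Re (\tr (X2 *m E))
    + complex.Re (\tr (X3 *m E)) + complex.Re (\tr (X4 *m E))
    + complex.Re (\tr (X5 *m E)) + complex.Re (\tr (X6 *m E)).
  by rewrite 5!mulmxDl 5!mxtraceD 5!ReD.
symmetry; apply: (etrans (sum6 _ _ _ _ _ _)).
set P11 := ulsubmx (ulsubmx Phi); set P12 := ursubmx (ulsubmx Phi).
set P22 := drsubmx (ulsubmx Phi).
set P13 := ulsubmx (ursubmx Phi); set P14 := ursubmx (ursubmx Phi).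
set P23 := dlsubmx (ursubmx Phi); set P24 := drsubmx (ursubmx Phi).
set P33 := ulsubmx (drsubmx Phi); set P34 := ursubmx (drsubmx Phi).
set P44 := drsubmx (drsubmx Phi).
transitivity (\tr (P11^T *m ReM (F11 Adt Bdt E)) + 2 * \tr (P12^T *m ReM (F12 E))
  + (2 * \tr (P13^T *m ReM (F13 Adt Bdt E)) - 2 * \tr (P14^T *m ImM (F13 Adt Bdt E)))
  + \tr (P22^T *m ReM (F11 Adp Bdp E))
  + (2 * \tr (P23^T *m ReM (F13 Adp Bdp E)) - 2 * \tr (P24^T *m ImM (F13 Adp Bdp E)))
  + (\tr (P33^T *m ReM (F33 E)) + \tr (P44^T *m ReM (F33 E))
    - 2 * \tr (P34^T *m ImM (F33 E)))).
  congr (_ + _ + _ + _ + _ + _); symmetry;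
    [exact: mxtrace_F11 | exact: mxtrace_F12 | exact: mxtrace_F13
    | exact: mxtrace_F11 | exact: mxtrace_F13 | exact: mxtrace_F33].
move: (F11 _ _ E) (F11 _ _ E) (F12 E).
move: (F13 _ _ E) (F13 _ _ E) (F33 E) => Z23 Z13 Z33 Z22 Z11 Z12.
have tr2 (P Z : 'M[R]_M) : \tr (P *m Z^T) = \tr (P^T *m Z).
  by rewrite -mxtrace_tr trmx_mul trmxK mxtrace_mulC.
have dl : dlsubmx Phi = (ursubmx Phi)^T by rewrite trmx_ursub symPhi.
have ul : dlsubmx (ulsubmx Phi) = (ursubmx (ulsubmx Phi))^T.
  by rewrite trmx_ursub trmx_ulsub symPhi.
have dr : dlsubmx (drsubmx Phi) = (ursubmx (drsubmx Phi))^T.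
  by rewrite trmx_ursub trmx_drsub symPhi.
(* The transposes are placed so that each plain [P] meets a transposed block of F and each [P^T] an
   untransposed one; [tr2] then makes the two kinds of terms agree. *)
have -> : Phi^T = block_mx (block_mx P11^T P12 P12^T P22^T) (block_mx P13 P14 P23 P24)
   (block_mx P13^T P23^T P14^T P24^T) (block_mx P33^T P34 P34^T P44^T).
  rewrite symPhi -[LHS]submxK -[ulsubmx Phi in LHS]submxK -[drsubmx Phi in LHS]submxK.
  rewrite dl -[ursubmx Phi in LHS]submxK ul dr tr_block_mx.
  by rewrite /P11 /P22 /P33 /P44 !(trmx_ulsub, trmx_drsub) symPhi.
rewrite !mulmx_block !mxtrace_block !add_block_mx !mxtrace_block.
have trN (Z : 'M[R]_M) : \tr (- Z) = - \tr Z by rewrite linearN.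
rewrite !mxtraceD !mulmxN !trN !tr2.
by ring.
Qed.

End Fisher.

(** * Derivatives at 0 of quadratic functions of a real parameter *)

Lemma is_derive_quadratic (R : realType) (c0 c1 c2 : R) :
  is_derive (0 : R) (1 : R) (fun t : R => c0 + t * (c1 + t * c2)) c1.
Proof.
pose p := c0%:P + 'X * (c1%:P + 'X * c2%:P).
have -> : (fun t : R => c0 + t * (c1 + t * c2)) = horner p.
  by apply/funext => t; rewrite /p !hornerE.
apply: (is_derive_eq (is_derive_horner p 0)).
by rewrite /p !(derivD, derivM, derivC, derivX) !hornerE; ring.
Qed.

(** The argument is a polynomial matrix in t with derivative [F1] at 0, and cyclicity collects the
    two inverses. This is the form that F takes along a line through W. *)
Lemma is_derive_mxtrace_invmx_quadratic (R : realType) (n : nat) (F0 F1 F2 : 'M[R]_n) :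
  F0 \in unitmx ->
  is_derive (0 : R) (1 : R) (fun t : R => \tr (invmx (F0 + t *: (F1 + t *: F2))))
    (- \tr (invmx F0 *m invmx F0 *m F1)).
Proof.
move=> F0u.
pose P : 'M[{poly R}]_n := map_mx polyC F0
  + 'X *: (map_mx polyC F1 + 'X *: map_mx polyC F2).
have evP t : map_mx (horner_eval t) P = F0 + t *: (F1 + t *: F2).
  by apply/matrixP=> i j; rewrite !mxE /horner_eval !hornerE.
have evP' : map_mx (horner_eval 0) (map_mx (@deriv R) P) = F1.
  apply/matrixP=> i j; rewrite !mxE /horner_eval.
  by rewrite !(derivD, derivM, derivC, derivX) !hornerE.
have evP0 : map_mx (horner_eval 0) P = F0 by rewrite evP scale0r addr0.
have -> : (fun t : R => \tr (invmx (F0 + t *: (F1 + t *: F2)))) =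
    (fun t : R => \tr (invmx (map_mx (horner_eval t) P))).
  by apply/funext => t; rewrite evP.
have := @is_derive_mxtrace_invmx R n P 0.
by rewrite /= evP0 evP' mxtrace_mulC mulmxA; apply.
Qed.

Lemma sum_line (S : comPzRingType) (I : finType) (P : pred I) (a b c : I -> S) t :
  \sum_(i | P i) (a i + t * (b i + t * c i)) =
  \sum_(i | P i) a i + t * (\sum_(i | P i) b i + t * \sum_(i | P i) c i).
Proof. by rewrite big_split -mulr_sumr big_split -mulr_sumr. Qed.

Lemma mulmx_lineE (S : comPzRingType) m n p (A : 'M[S]_(m, n)) (X Y : 'M[S]_(n, p))
    c i j :
  (A *m (X + c *: Y)) i j = (A *m X) i j + c * (A *m Y) i j.
Proof. by rewrite mulmxDr -scalemxAr [LHS]mxE; congr (_ + _); rewrite mxE. Qed.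

(** * The communication rates and the gradient of their sum *)

Section Comm.
Variable R : realType.
Local Notation C := (R[i]).
Variables (Nt K Ns : nat) (H : 'M[C]_(Nt, K)) (sigc2 : 'I_K -> R).
Hypothesis sigc2_gt0 : forall k, 0 < sigc2 k.
Implicit Types (W D : 'M[C]_(Nt, K + Ns)) (k : 'I_K) (t : R) (x y : C).

(** The differential of the squared modulus at [x] in the direction [y]. *)
Definition dsqn x y : R := 2 * complex.Re (x^* * y).

Lemma sqn_line x y t :
  sqn (x + t%:C * y) = sqn x + t * (dsqn x y + t * sqn y).
Proof. by case: x y => [a b] [c d]; rewrite /sqn /dsqn /=; ring. Qed.

Lemma sqn_ge0 x : 0 <= sqn x.
Proof. by rewrite addr_ge0 ?sqr_ge0. Qed.

Lemma hw_line W D k j t : hw H (W + t%:C *: D) k j = hw H W k j + t%:C * hw H D k j.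
Proof.
rewrite /hw (_ : lsubmx _ = lsubmx W + t%:C *: lsubmx D).
  exact: mulmx_lineE.
by apply/matrixP=> i l; rewrite !mxE.
Qed.

Definition hs W k (l : 'I_Ns) : C := (ctr H *m rsubmx W) k l.

Lemma hs_line W D k l t : hs (W + t%:C *: D) k l = hs W k l + t%:C * hs D k l.
Proof.
rewrite /hs (_ : rsubmx _ = rsubmx W + t%:C *: rsubmx D).
  exact: mulmx_lineE.
by apply/matrixP=> i j; rewrite !mxE.
Qed.

Definition dIk W D k : R :=
  \sum_(j < K | j != k) dsqn (hw H W k j) (hw H D k j)
  + \sum_(l < Ns) dsqn (hs W k l) (hs D k l).

(** The quadratic coefficient stays existential: it does not affect the derivative at 0. *)
Lemma Ik_line W D k : exists c : R, forall t,
  Ik H sigc2 (W + t%:C *: D) k = Ik H sigc2 W k + t * (dIk W D k + t * c).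
Proof.
exists (\sum_(j < K | j != k) sqn (hw H D k j) + \sum_(l < Ns) sqn (hs D k l)) => t.
transitivity (
  (\sum_(j < K | j != k) sqn (hw H W k j)
    + t * (\sum_(j < K | j != k) dsqn (hw H W k j) (hw H D k j)
            + t * \sum_(j < K | j != k) sqn (hw H D k j)))
  + (\sum_(l < Ns) sqn (hs W k l)
    + t * (\sum_(l < Ns) dsqn (hs W k l) (hs D k l)
            + t * \sum_(l < Ns) sqn (hs D k l))) + sigc2 k).
  congr (_ + _ + _); rewrite -sum_line; apply: eq_bigr => j _.
    by rewrite hw_line sqn_line.
  exact: etrans (congr1 _ (hs_line _ _ _ _ _)) (sqn_line _ _ _).
rewrite /Ik /dIk.
move: (\sum_(j < K | j != k) _) (\sum_(j < K | j != k) _) (\sum_(j < K | j != k) _).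
move: (\sum_(l < Ns) _) (\sum_(l < Ns) _) (\sum_(l < Ns) _).
by move=> a1 a2 a3 a4 a5 a6; ring.
Qed.

Lemma Ik_gt0 W k : 0 < Ik H sigc2 W k.
Proof.
by rewrite /Ik ltr_wpDl // addr_ge0 // sumr_ge0 // => j _; exact: sqn_ge0.
Qed.

Definition dTk W D k : R := dIk W D k + dsqn (hw H W k k) (hw H D k k).

(** The rate is ln T - ln I, with T = I + S. Its derivative dT/T - dI/I equals dS/I - (1/I - 1/T)
    dT, and 1/I - 1/T = S/(I T) is [betak]. *)
Lemma is_derive_rate W D k :
  is_derive (0 : R) (1 : R) (fun t : R => rate H sigc2 (W + t%:C *: D) k)
    (dsqn (hw H W k k) (hw H D k k) / Ik H sigc2 W k - betak H sigc2 W k * dTk W D k).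
Proof.
have [c IE] := Ik_line W D k.
have I0 := Ik_gt0 W k; have S0 := sqn_ge0 (hw H W k k).
set I := Ik H sigc2 W k in IE I0 *.
set S := sqn (hw H W k k) in S0 *.
set dS := dsqn _ _.
have dI := is_derive_quadratic I (dIk W D k) c.
have dSq := is_derive_quadratic S dS (sqn (hw H D k k)).
have -> : (fun t : R => rate H sigc2 (W + t%:C *: D) k) =
   @ln R \o ((cst 1) + (fun t => S + t * (dS + t * sqn (hw H D k k))) *
        (fun t => (I + t * (dIk W D k + t * c))^-1)).
  by apply/funext => t; rewrite /rate IE hw_line sqn_line.
pose f t := I + t * (dIk W D k + t * c).
have f0 : f 0 != 0 by rewrite /f mul0r addr0 gt_eqF.
have dq := is_deriveD (is_derive_cst (1 : R) (0 : R) (1 : R))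
  (is_deriveM dSq (is_deriveV f0 dI)).
have pos : 0 < 1 + S / I by rewrite ltr_pwDl // divr_ge0 // ltW.
set g := (cst 1 + _ : R -> R).
have g0 : g 0 = 1 + S / I.
  change (1 + (S + 0 * (dS + 0 * sqn (hw H D k k))) * (f 0)^-1 = 1 + S / I).
  by rewrite /f !mul0r !addr0.
have dl : is_derive (g 0) (1 : R) (@ln R) (1 + S / I)^-1.
  by rewrite g0; exact: is_derive1_ln.
apply: (is_derive_eq (is_derive1_comp dl dq)).
rewrite /betak /xik /Tk /dTk -/I -/S -/dS /f /GRing.scale /= !mul0r !addr0.
field.
by rewrite !gt_eqF // ltr_pwDl.
Qed.

Lemma Re_mxtrace_ctr_mul m n (Y Z : 'M[C]_(m, n)) :
  complex.Re (\tr (ctr Y *m Z)) = \sum_k \sum_j complex.Re ((Y k j)^* * Z k j).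
Proof.
rewrite /mxtrace Re_sum exchange_big /=; apply: eq_bigr => j _.
by rewrite mxE Re_sum; apply: eq_bigr => k _; rewrite !mxE.
Qed.

Lemma Re_mul_divc x y (r : R) :
  complex.Re (x / r%:C * y) = complex.Re (x * y) / r.
Proof.
have -> : (r%:C)^-1 = (r^-1)%:C :> C by exact: esym (fmorphV (real_complex R) r).
by rewrite (mulrC x) -mulrA ReZ mulrC.
Qed.

Lemma Re_conj_mulC x y (r : R) :
  complex.Re (y^* * (r%:C * x)) = r * complex.Re (x^* * y).
Proof. by case: x y => [a b] [c d] /=; ring. Qed.

(** Unlike I_k, T_k gathers the power of all columns of W, so its derivative pairs full rows of H^H
    W and H^H D. This is why Sigma2 acts on the whole of W. *)
Lemma dTkE W D k :
  dTk W D k = 2 * \sum_j complex.Re (((ctr H *m W) k j)^* * (ctr H *m D) k j).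
Proof.
have lE X j : (ctr H *m X) k (lshift Ns j) = hw H X k j.
  by rewrite /hw mulmx_lsub [RHS]mxE.
have rE X l : (ctr H *m X) k (rshift K l) = hs X k l.
  by rewrite /hs mulmx_rsub [RHS]mxE.
rewrite big_split_ord mulrDr !mulr_sumr /dTk /dIk -addrA (addrC (\sum_l _)) addrA.
congr (_ + _).
  by rewrite [RHS](bigD1 k) // addrC; congr (_ + _);
    [rewrite !lE | apply: eq_bigr => j _; rewrite !lE].
by apply: eq_bigr => l _; rewrite !rE.
Qed.

Lemma diag_mx_mulE (S : comPzRingType) m n (d : 'I_m -> S) (A : 'M[S]_(m, n)) i j :
  (diag_mx (\row_k d k) *m A) i j = d i * A i j.
Proof. by rewrite mul_diag_mx !mxE. Qed.

Lemma sum_rate_gradient W D :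
  \sum_k (dsqn (hw H W k k) (hw H D k k) / Ik H sigc2 W k
          - betak H sigc2 W k * dTk W D k) =
  2 * complex.Re (\tr (ctr (lsubmx D) *m (H *m ctr (Sigma1 H sigc2 W))))
  - 2 * complex.Re (\tr (ctr D *m (H *m Sigma2 H sigc2 W *m ctr H *m W))).
Proof.
have ctrH m (X : 'M[C]_(Nt, m)) : ctr X *m H = ctr (ctr H *m X).
  by rewrite ctrM ctrK.
rewrite big_split sumrN; congr (_ - _).
  (* Conjugate transposition preserves the real part and gives the trace of Sigma1 H^H D_c, with
     diagonal entries [etak] times h_k^H d_k. *)
  rewrite mulmxA ctrH -ctrM Re_mxtrace_ctr /mxtrace Re_sum mulr_sumr.
  apply: eq_bigr => k _.
  rewrite diag_mx_mulE /etak /dsqn -/(hw H D k k).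
  by rewrite Re_mul_divc mulrA.
(* Grouping as (H^H D)^H (Sigma2 H^H W) gives an entrywise sum weighted by [betak], matching
   [dTkE]. *)
rewrite -(mulmxA _ (ctr H)) -(mulmxA H) mulmxA ctrH Re_mxtrace_ctr_mul mulr_sumr.
apply: eq_bigr => k _; rewrite dTkE mulrCA; congr (_ * _).
rewrite mulr_sumr; apply: eq_bigr => j _.
by rewrite diag_mx_mulE Re_conj_mulC.
Qed.

End Comm.

(** * The derivative of the Lagrangian along a direction *)

Lemma gram_line (R : realType) m n (W D : 'M[R[i]]_(m, n)) (t : R) :
  (W + t%:C *: D) *m ctr (W + t%:C *: D) =
  W *m ctr W + t%:C *: ((D *m ctr W + W *m ctr D) + t%:C *: (D *m ctr D)).
Proof.
rewrite ctrD ctrZ mulmxDl 2!mulmxDr -!scalemxAr -!scalemxAl !scalerDr.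
by rewrite -!addrA; congr (_ + _); rewrite addrCA.
Qed.

(** The cross terms D W^H and W D^H are conjugate transposes of each other, so their traces have
    equal real parts. *)
Lemma is_derive_Re_mxtrace_gram (R : realType) m n (W D : 'M[R[i]]_(m, n)) :
  is_derive (0 : R) (1 : R)
    (fun t : R => complex.Re (\tr ((W + t%:C *: D) *m ctr (W + t%:C *: D))))
    (2 * complex.Re (\tr (ctr D *m W))).
Proof.
have -> : 2 * complex.Re (\tr (ctr D *m W)) =
    complex.Re (\tr (D *m ctr W + W *m ctr D)).
  rewrite mxtraceD ReD -[X in X + _]Re_mxtrace_ctr ctrM ctrK.
  by rewrite (mxtrace_mulC W) mulrDl mul1r.
have := is_derive_quadratic (complex.Re (\tr (W *m ctr W)))
  (complex.Re (\tr (D *m ctr W + W *m ctr D))) (complex.Re (\tr (D *m ctr D))).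
congr (is_derive _ _ _ _); apply/funext => t.
by rewrite gram_line (mxtraceD (W *m _)) mxtraceZ (mxtraceD (_ + _)) mxtraceZ ReD ReZ ReD ReZ.
Qed.

Lemma is_derive_mxtrace_invmx_Fmat (R : realType) (Nt Nr M n L : nat)
    (A Adt Adp : 'M[R[i]]_(Nt, M)) (B Bdt Bdp : 'M[R[i]]_(Nr, M))
    (U : 'M[R[i]]_M) (sigs2 : R) (W D : 'M[R[i]]_(Nt, n)) :
  let F X := Fmat A Adt Adp B Bdt Bdp U L sigs2 X in
  let V := invmx (F (W *m ctr W)) in
  let Q := Qmat A Adt Adp B Bdt Bdp U L sigs2 (V *m V) in
  F (W *m ctr W) \in unitmx ->
  is_derive (0 : R) (1 : R)
    (fun t : R => \tr (invmx (F ((W + t%:C *: D) *m ctr (W + t%:C *: D)))))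
    (- complex.Re (\tr (ctr D *m ((Q + ctr Q) *m W)))).
Proof.
move=> F V Q Fu.
set E := D *m ctr W + W *m ctr D.
have symV : V^T = V by rewrite /V trmx_inv trmx_Fmat // ctrM ctrK.
(* By duality the right side is Re tr (Q E). The summand W D^H of [E] contributes Q, and D W^H
   contributes Q^H after conjugate transposition. No factor 2 appears, hence the 1/2 in front of Q +
   Q^H in the theorem. *)
have QE : complex.Re (\tr (ctr D *m ((Q + ctr Q) *m W))) = \tr (V *m V *m F E).
  rewrite mxtrace_Fmat; last by rewrite trmx_mul symV.
  rewrite -/Q /E mulmxDl mulmxDr mulmxDr !mxtraceD !ReD addrC; congr (_ + _).
    rewrite -[LHS]Re_mxtrace_ctr !ctrM !ctrK.
    by rewrite -mulmxA mxtrace_mulC -mulmxA.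
  by rewrite mxtrace_mulC mulmxA.
rewrite QE.
have := is_derive_mxtrace_invmx_quadratic (F E) (F (D *m ctr D)) Fu.
congr (is_derive _ _ _ _); apply/funext => t.
by rewrite gram_line /F !Fmat_lin.
Qed.

Lemma is_derive_lagr (R : realType) (Nt Nr K Ns M L : nat)
    (H : 'M[R[i]]_(Nt, K)) (sigc2 : 'I_K -> R)
    (A Adt Adp : 'M[R[i]]_(Nt, M)) (B Bdt Bdp : 'M[R[i]]_(Nr, M))
    (U : 'M[R[i]]_M) (sigs2 dc ds Pt mu : R) (W D : 'M[R[i]]_(Nt, K + Ns)) :
  let F X := Fmat A Adt Adp B Bdt Bdp U L sigs2 X in
  let V := invmx (F (W *m ctr W)) in
  let Q := Qmat A Adt Adp B Bdt Bdp U L sigs2 (V *m V) in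
  (forall k, 0 < sigc2 k) ->
  F (W *m ctr W) \in unitmx ->
  is_derive (0 : R) (1 : R)
    (fun t : R => lagr H sigc2 A Adt Adp B Bdt Bdp U L sigs2 dc ds Pt (W + t%:C *: D) mu)
    (dc * (2 * complex.Re (\tr (ctr (lsubmx D) *m (H *m ctr (Sigma1 H sigc2 W))))
           - 2 * complex.Re (\tr (ctr D *m (H *m Sigma2 H sigc2 W *m ctr H *m W))))
     + ds * complex.Re (\tr (ctr D *m ((Q + ctr Q) *m W)))
     - mu * (2 * complex.Re (\tr (ctr D *m W)))).
Proof.
move=> F V Q s0 Fu.
have dR := is_derive_sum (fun k => is_derive_rate H s0 W D k).
have dF := is_derive_mxtrace_invmx_Fmat D Fu.
have dT := is_derive_Re_mxtrace_gram W D.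
have d := is_deriveB (is_deriveB (is_deriveZ dc dR) (is_deriveZ ds dF))
  (is_deriveZ mu (is_deriveB dT (is_derive_cst Pt (0 : R) (1 : R)))).
(* The Lagrangian is rewritten with pointwise operations on functions, the form to which the
   differentiation rules in [d] apply. *)
have -> : (fun t : R => lagr H sigc2 A Adt Adp B Bdt Bdp U L sigs2 dc ds Pt (W + t%:C *: D) mu)
  = (dc \*: (\sum_(k < K) (fun t : R => rate H sigc2 (W + t%:C *: D) k))
    - ds \*: (fun t : R => \tr (invmx (F ((W + t%:C *: D) *m ctr (W + t%:C *: D)))))
    - mu \*: ((fun t : R => complex.Re (\tr ((W + t%:C *: D) *m ctr (W + t%:C *: D)))) - cst Pt)).
  apply/funext => t; rewrite /lagr /fobj.
  have -> : \sum_(k < K) rate H sigc2 (W + t%:C *: D) k =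
     (\sum_(k < K) (fun t : R => rate H sigc2 (W + t%:C *: D) k)) t by rewrite fct_sumE.
  by [].
apply: (is_derive_eq d).
rewrite sum_rate_gradient /GRing.scale /=.
by ring.
Qed.

(** * From stationarity to the matrix equations *)

Lemma Re_mxtrace_ctr_delta (R : realType) m n (c : R[i]) i j (G : 'M[R[i]]_(m, n)) :
  complex.Re (\tr (ctr (c *: delta_mx i j) *m G)) = complex.Re (c^* * G i j).
Proof.
rewrite Re_mxtrace_ctr_mul (bigD1 i) // (bigD1 j) //= !big1 ?addr0.
- by rewrite !mxE !eqxx mulr1.
- move=> k ki; rewrite big1 // => l _.
  by rewrite !mxE (negPf ki); case: c (G k l) => [a b] [u v] /=; ring.
- move=> l lj; rewrite !mxE (negPf lj) andbF.
  by case: c (G i l) => [a b] [u v] /=; ring.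
Qed.

(** By uniqueness of derivatives, the directions [delta_mx i j] and ['i *: delta_mx i j] give Re
    G_ij = 0 and Re (- i G_ij) = Im G_ij = 0. *)
Lemma grad_zero_eq0 (R : realType) m n (g : 'M[R[i]]_(m, n) -> R) (W G : 'M[R[i]]_(m, n)) :
  grad_zero g W ->
  (forall D, is_derive (0 : R) (1 : R) (fun t : R => g (W + t%:C *: D))
               (2 * complex.Re (\tr (ctr D *m G)))) ->
  G = 0.
Proof.
move=> g0 dg.
have G0 (c : R[i]) i j :
    is_derive (0 : R) (1 : R) (fun t : R => g (W + t%:C *: (c *: delta_mx i j))) 0 ->
    complex.Re (c^* * G i j) = 0.
  move=> d0; have d1 := dg (c *: delta_mx i j).
  have := @derive_val _ _ _ _ _ _ _ d1; rewrite (@derive_val _ _ _ _ _ _ _ d0).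
  rewrite Re_mxtrace_ctr_delta => /esym/eqP.
  by rewrite mulf_eq0 pnatr_eq0 /= => /eqP.
apply/matrixP=> i j; rewrite [RHS]mxE.
have [d1 d2] := g0 i j.
have ReG : complex.Re (G i j) = 0.
  have := @G0 1 i j; rewrite scale1r => /(_ d1).
  by case: (G i j) => u v /= <-; ring.
have ImG : complex.Im (G i j) = 0.
  have e : (fun t : R => g (W + t%:C *: ('i *: delta_mx i j))) =
           (fun t : R => g (W + (t%:C * 'i) *: delta_mx i j)).
    by apply/funext => t; rewrite scalerA.
  have := @G0 'i i j; rewrite e => /(_ d2).
  by case: (G i j) => u v /=; rewrite mul0r mulN1r sub0r opprK.
by case: (G i j) ReG ImG => u v /= -> ->.
Qed.

(** The Sigma1 term involves only the first column block of the direction; padding it with zeros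
    makes it a pairing with the full [D]. *)
Lemma mxtrace_ctr_row0 (R : realType) m n1 n2 (D : 'M[R[i]]_(m, n1 + n2))
    (X : 'M[R[i]]_(m, n1)) :
  \tr (ctr D *m row_mx X 0) = \tr (ctr (lsubmx D) *m X).
Proof.
rewrite mxtrace_mulC -{1}[D]hsubmxK /ctr map_row_mx tr_row_mx mul_row_col.
by rewrite mul0mx addr0 mxtrace_mulC.
Qed.

Lemma Re_mxtrace_mul_lin (R : realType) m n (T : 'M[R[i]]_(n, m)) (W : 'M[R[i]]_(m, n))
    (Z1 Z2 : 'M[R[i]]_m) (c1 c2 c3 : R) :
  complex.Re (\tr (T *m ((c1%:C *: Z1 - c2%:C *: Z2 - (c3%:C)%:M) *m W))) =
  c1 * complex.Re (\tr (T *m (Z1 *m W))) - c2 * complex.Re (\tr (T *m (Z2 *m W)))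
  - c3 * complex.Re (\tr (T *m W)).
Proof.
have ReB (X Y : 'M[R[i]]_n) :
    complex.Re (\tr (X - Y)) = complex.Re (\tr X) - complex.Re (\tr Y).
  by rewrite mxtraceD ReD -ReN; congr (_ + complex.Re _); rewrite linearN.
rewrite mulmxBl mulmxBl mul_scalar_mx -!scalemxAl.
move: (Z1 *m W) (Z2 *m W) => Y1 Y2.
by rewrite 2!mulmxBr -!scalemxAr 2!ReB 3!mxtraceZ 3!ReZ.
Qed.

Theorem theorem1 (R : realType) (Nt Nr K M L Ns : nat)
  (H : 'M[R[i]]_(Nt, K)) (sigc2 : 'I_K -> R) (sigs2 dc ds Pt : R)
  (a : R * R -> 'I_Nt -> R[i]) (b : R * R -> 'I_Nr -> R[i])
  (th ph : 'I_M -> R) (alpha : 'I_M -> R[i])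
  (Wd : 'M[R[i]]_(Nt, K + Ns)) (mud : R) :
  (0 < Nt)%N -> (0 < Nr)%N -> (0 < K)%N -> (0 < M)%N -> (0 < L)%N ->
  (forall k, 0 < sigc2 k) -> 0 < sigs2 -> 0 <= dc -> 0 <= ds -> 0 < Pt ->
  (forall (k : 'I_Nt) (p : R * R),
     differentiable (fun q : R * R => complex.Re (a q k)) p /\
     differentiable (fun q : R * R => complex.Im (a q k)) p) ->
  (forall (k : 'I_Nr) (p : R * R),
     differentiable (fun q : R * R => complex.Re (b q k)) p /\
     differentiable (fun q : R * R => complex.Im (b q k)) p) ->
  let A := steer a th ph in
  let B := steer b th ph in
  let Adt := dsteer a (1, 0) th ph in
  let Adp := dsteer a (0, 1) th ph in
  let Bdt := dsteer b (1, 0) th ph in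
  let Bdp := dsteer b (0, 1) th ph in
  let U := Umat alpha in
  let Fm := fun W : 'M[R[i]]_(Nt, K + Ns) =>
              Fmat A Adt Adp B Bdt Bdp U L sigs2 (W *m ctr W) in
  Fm Wd \in unitmx ->
  grad_zero (fun W => lagr H sigc2 A Adt Adp B Bdt Bdp U L sigs2 dc ds Pt W mud) Wd ->
  let Phi := invmx (Fm Wd) *m invmx (Fm Wd) in
  let Q := Qmat A Adt Adp B Bdt Bdp U L sigs2 Phi in
  let S1 := Sigma1 H sigc2 Wd in
  let S2 := Sigma2 H sigc2 Wd in
  let Wc := lsubmx Wd in
  let Ws := rsubmx Wd in
  ((2^-1 * ds)%:C *: (Q + ctr Q) - dc%:C *: (H *m S2 *m ctr H)) *m Ws = mud%:C *: Ws /\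
  (let G := mud%:C%:M + dc%:C *: (H *m S2 *m ctr H) - (2^-1 * ds)%:C *: (Q + ctr Q) in
   G \in unitmx -> Wc = invmx G *m (dc%:C *: (H *m ctr S1))).
Proof.
move=> _ _ _ _ _ s0 _ _ _ _ _ _ A B Adt Adp Bdt Bdp U Fm Fu g0 Phi Q S1 S2 Wc Ws.
set HS := H *m S2 *m ctr H; set HQ := Q + ctr Q; set HS1 := H *m ctr S1.
(* [Z] is the opposite of the matrix inverted in the second claim, and [Gr] is half the gradient of
   the Lagrangian at [Wd]. *)
pose Z := (2^-1 * ds)%:C *: HQ - dc%:C *: HS - mud%:C%:M.
pose Gr := row_mx (dc%:C *: HS1) 0 + Z *m Wd.
have Gr0 : Gr = 0.
  apply: (grad_zero_eq0 g0) => D.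
  have dl := @is_derive_lagr R Nt Nr K Ns M L H sigc2 A Adt Adp B Bdt Bdp U
    sigs2 dc ds Pt mud Wd D s0 Fu.
  refine (is_derive_eq dl _).
  rewrite -/Phi -/Q -/HQ -/S1 -/S2 -/HS -/HS1.
  have -> : complex.Re (\tr (ctr D *m Gr)) =
      dc * complex.Re (\tr (ctr (lsubmx D) *m HS1))
    + ((2^-1 * ds) * complex.Re (\tr (ctr D *m (HQ *m Wd)))
    - dc * complex.Re (\tr (ctr D *m (HS *m Wd)))
    - mud * complex.Re (\tr (ctr D *m Wd))).
    rewrite mulmxDr mxtraceD mxtrace_ctr_row0 ReD -scalemxAr mxtraceZ ReZ.
    by congr (_ + _); exact: Re_mxtrace_mul_lin.
  by field.
have Wc0 : dc%:C *: HS1 + Z *m Wc = 0.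
  have := congr1 lsubmx Gr0; rewrite /Gr linearD /= row_mxKl -mulmx_lsub => ->.
  by rewrite linear0.
have Ws0 : Z *m Ws = 0.
  have := congr1 rsubmx Gr0; rewrite /Gr linearD /= row_mxKr -mulmx_rsub add0r => ->.
  by rewrite linear0.
split.
  by apply: subr0_eq; rewrite -[RHS]Ws0 /Z [RHS]mulmxBl mul_scalar_mx.
move=> G Gu.
(* The first column block thus reads G Wc = dc H Sigma1^H, and [G] cancels on the left. *)
have GZ : G = - Z by rewrite /G /Z !opprB addrA.
rewrite -[LHS](mulKmx Gu); congr (_ *m _).
by rewrite GZ mulNmx; apply/esym/eqP; rewrite -addr_eq0 Wc0.
Qed.
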